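(* For each positive integer $m$, $$\zeta^{\star}(\{2\}^{m-1},3,\{2\}^{m-1},1)=2\pi^{4m}\left(\frac{(1-2^{2m-1})B_{2m}}{(2m)!}\right)^2,$$ $$\zeta^{\star}(\{2\}^{m-1},3,\{2\}^{m-1},1,\{2\}^m)=\frac{\pi^{6m}}{3}\left(\frac{(2^{2m}-2)^3B_{2m}^3}{2\cdot((2m)!)^3}+\frac{(2^{6m}-2)B_{6m}}{(6m)!}\right),$$ $$\zeta^{\star}(\{2\}^{m-1},3,\{2\}^{m-1},1,\{2\}^{m-1},3,\{2\}^{m-1},1)=\frac{(2-2^{2m})B_{2m}\,\pi^{8m}}{3\cdot(2m)!}\left(\frac{(1-2^{2m-1})^3B_{2m}^3}{((2m)!)^3}+\frac{(2-2^{6m})B_{6m}}{(6m)!}\right).$$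
   Context: For positive integers $s_1,\ldots,s_r$ with $s_1>1$, the multiple zeta star value is $\zeta^\star(s_1,\ldots,s_r)=\sum_{k_1\ge\cdots\ge k_r\ge 1}\frac{1}{k_1^{s_1}\cdots k_r^{s_r}}$ (sum over positive integers). $\{2\}^a$ denotes the number $2$ repeated $a$ times (nothing if $a=0$). The Bernoulli numbers $B_s$ are defined by $\frac{t}{e^t-1}=\sum_{s=0}^\infty B_s\frac{t^s}{s!}$.
   Formalization: The right-hand side of the second identity is multiplied by (-1)^{m-1}; as printed it is false for every even m, since B_{2m} and B_{6m} are then negative while the zeta star value is a sum of positive terms (e.g. m=2). *)

(* Defs.v *)
From HB Require Import structures.
From mathcomp Require Import all_boot all_order all_algebra.
From mathcomp Require Import all_classical all_reals all_analysis.

Set Implicit Arguments.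
Unset Strict Implicit.
Unset Printing Implicit Defensive.

Import Order.TTheory GRing.Theory Num.Theory.
Import numFieldNormedType.Exports.

Local Open Scope classical_set_scope.
Local Open Scope ring_scope.

Definition star_indices (r : nat) : set (r.-tuple nat) :=
  [set k | all (leq 1) k && sorted geq k].

(* The terms are nonnegative, so the iterated series is the sum over the
   family of all index tuples. It takes values in \bar R, and an equation
   [mzstar R s = x%:E] includes the convergence of the series. *)
Definition mzstar (R : realType) (s : seq nat) : \bar R :=
  \esum_(k in @star_indices (size s))
    (\prod_(i < size s) (tnth k i)%:R ^- nth 0%N s i)%:E.

(* The function t / (e^t - 1) has a removable singularity at 0, hence the
   punctured neighbourhood. By uniqueness of power series coefficients, this
   condition determines B. *)
Definition bernoulli_numbers (R : realType) (B : nat -> R) : Prop :=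
  \forall t \near 0^',
    series (fun s => B s * (t ^+ s / s`!%:R)) @ \oo --> t / (expR t - 1).

(* Main.v *)
Require Import Defs.
From mathcomp Require Import all_boot all_order all_algebra.
From mathcomp Require Import ring lra.
From mathcomp Require Import all_classical all_reals all_analysis.
Import Order.TTheory GRing.Theory Num.Theory.
Import numFieldNormedType.Exports.

Set Implicit Arguments.
Unset Strict Implicit.
Unset Printing Implicit Defensive.

(** Write a nested sum over k_1 >= ... >= k_r with k_1 <= n as the result of
applying summation operators A_s, where A_s f (n) is the sum of f k / k ^ s for
1 <= k <= n, to the constant 1. The weights binw n k, which equal
'C(2n, n+k) / 'C(2n, n), give a transform wsum F n = \sum_k binw n k * F k that
diagonalizes A_2: applying A_2 to wsum F divides F k by k ^ 2 ([psum_wsum]).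
Multiplication by n also acts nicely: n * wsum F n is the transform of
k * pairsum F k ([wsum_pairsum]), where pairsum F k counts F k once and each
F l with l < k twice. Conjugating by the signs (-1) ^ k inverts pairsum
([pairsum_sign]). Hence the word {2}^(m-1), 3, {2}^(m-1), 1 turns wsum F into
the transform of X P X P F, where P is pairsum and X multiplies by
x_k = (-1) ^ k / k ^ (2m) ([starsum_block]).

The constant 1 is the transform of -2 (-1) ^ k, which P maps to 2, so the three
words produce, up to sign, the iterates (X P) ^ d applied to 2 x_k. Their sums
over k are the coefficients q_(d+1) of the product of the
(1 + x_k t) / (1 - x_k t). Its logarithm is twice the sum of p_i t ^ i / i
over odd i, p_i being the power sums of the x_k; so q_2, q_3 and q_4 are
polynomials in p_1 and p_3 only ([psum_qterm1] to [psum_qterm3]). As n grows,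
binw n k tends to 1 and stays in [0, 1], and the transform tends to the plain
sum by Tannery's argument ([wsum_cvg]); [mzstar_lim] identifies this limit with
the sum over all index tuples. The limits of p_1 and p_3 are the values of the
alternating sums of (-1) ^ k / k ^ (2j) at j = m and j = 3m.

Euler's formula for these values comes from the same transform. The inverse of
the product of the 1 + z ^ 2 / k ^ 2, k <= n, has a partial fraction expansion
with weights binw n k ([sinhprod_inv]), and the product tends to
sinh (pi z) / (pi z) ([sinhprod_cvg]). In the limit pi z / sinh (pi z) has a
Taylor expansion at 0 with the alternating sums as coefficients
([invsinhc_expansion]). The identity t / sinh t = 2 f(t) - f(2t) for
f(t) = t / (e^t - 1) gives a second expansion, in Bernoulli numbers
([bernoulli_invsinhc]); comparing coefficients yields [altzeta_bernoulli]. *)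

Local Open Scope ring_scope.

(** * Nested star sums and binomial weights *)

Section FiniteSums.
Context {K : realFieldType}.
Implicit Types (F G : nat -> K) (n k l m : nat).

Definition psum F n : K := \sum_(1 <= k < n.+1) F k.

(** The closed form n!^2 / ((n - k)! (n + k)!) = 'C(2n, n+k) / 'C(2n, n) is
written as a product so that it vanishes by itself for k > n and the recurrence
in k is immediate. *)
Definition binw n k : K := \prod_(0 <= i < k) ((n%:R - i%:R) / (n + i).+1%:R).

Definition wsum F n : K := \sum_(1 <= k < n.+1) binw n k * F k.

Lemma psum0 F : psum F 0 = 0.
Proof. by rewrite /psum big_geq. Qed.

Lemma psumS F n : psum F n.+1 = psum F n + F n.+1.
Proof. by rewrite /psum big_nat_recr. Qed.

Lemma eq_psum F G : (forall k, (0 < k)%N -> F k = G k) -> psum F =1 psum G.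
Proof. by move=> FG n; apply: eq_big_nat => k /andP[k1 _]; exact: FG. Qed.

Lemma psumN F n : psum (fun k => - F k) n = - psum F n.
Proof. by rewrite /psum sumrN. Qed.

Lemma binwS n k : binw n k.+1 * (n + k).+1%:R = binw n k * (n%:R - k%:R).
Proof.
rewrite /binw big_nat_recr//= -mulrA; congr *%R.
by rewrite mulfVK// pnatr_eq0.
Qed.

Lemma binw_gt n k : (n < k)%N -> binw n k = 0.
Proof.
move=> nk; rewrite /binw (big_cat_nat (n := n))//=; last exact: ltnW.
by rewrite [X in _ * X]big_ltn//= subrr mul0r mul0r mulr0.
Qed.

Lemma binw_predn n k :
  n.+1%:R ^+ 2 * binw n k = (n.+1%:R ^+ 2 - k%:R ^+ 2) * binw n.+1 k.
Proof.
elim: k => [|k IHk]; first by rewrite /binw !big_geq// expr0n subr0.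
have nk1 : (n + k).+1%:R != 0 :> K by rewrite pnatr_eq0.
have nk2 : (n.+1 + k).+1%:R != 0 :> K by rewrite pnatr_eq0.
apply: (mulIf nk1); apply: (mulIf nk2).
transitivity (n.+1%:R ^+ 2 * (binw n k.+1 * (n + k).+1%:R) * (n.+1 + k).+1%:R);
  first by ring.
transitivity ((n.+1%:R ^+ 2 - k.+1%:R ^+ 2) * (n + k).+1%:R
   * (binw n.+1 k.+1 * (n.+1 + k).+1%:R)); last by ring.
rewrite !binwS.
transitivity (n.+1%:R ^+ 2 * binw n k * (n%:R - k%:R) * (n.+1 + k).+1%:R);
  first by ring.
by rewrite IHk; ring.
Qed.

Lemma wsumS_sub F n :
  n.+1%:R ^+ 2 * (wsum F n.+1 - wsum F n) =
  wsum (fun k => k%:R ^+ 2 * F k) n.+1.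
Proof.
have -> : wsum F n = \sum_(1 <= k < n.+2) binw n k * F k.
  by rewrite [RHS]big_nat_recr//= binw_gt// mul0r addr0.
rewrite /wsum -sumrB mulr_sumr; apply: eq_bigr => k _.
transitivity (n.+1%:R ^+ 2 * binw n.+1 k * F k - n.+1%:R ^+ 2 * binw n k * F k);
  first by ring.
by rewrite binw_predn; ring.
Qed.

Lemma eq_wsum F G : (forall k, (0 < k)%N -> F k = G k) -> wsum F =1 wsum G.
Proof.
by move=> FG n; apply: eq_big_nat => k /andP[k1 _]; rewrite FG.
Qed.

(** By [binw_predn], the increment of wsum F from n-1 to n is n ^ -2 times the
transform of k ^ 2 * F k; summing over n gives the claim with F k / k ^ 2 in
place of F k. *)
Lemma psum_wsum F : psum (fun n => wsum F n / n%:R ^+ 2) =1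
  wsum (fun k => F k / k%:R ^+ 2).
Proof.
elim=> [|n IHn]; first by rewrite psum0 /wsum big_geq.
have n0 : n.+1%:R ^+ 2 != 0 :> K by rewrite expf_neq0// pnatr_eq0.
have : n.+1%:R ^+ 2 * (wsum (fun k => F k / k%:R ^+ 2) n.+1
    - wsum (fun k => F k / k%:R ^+ 2) n) = wsum F n.+1.
  rewrite wsumS_sub; apply: eq_wsum => k k0.
  by rewrite mulrCA divff ?mulr1// expf_neq0// pnatr_eq0 -lt0n.
by rewrite psumS IHn => <-; rewrite [_ * _ / _]mulrAC divff// mul1r subrKC.
Qed.

(** In other words F n + 2 * \sum_(1 <= k < n) F k: the generating function
of the weight that counts equal indices once and strict inequalities twice. At
n = 0 both terms are empty. *)
Definition pairsum F n : K := psum F n + psum F n.-1.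

(** Equivalent to the kernel identity
(n - k) * binw n k = \sum_(k < l <= n) 2 * l * binw n l, which telescopes by
[binwS]; the partial summation is done at once for the whole sum. *)
Lemma wsum_pairsum F n : wsum (fun k => k%:R * pairsum F k) n = n%:R * wsum F n.
Proof.
have H M : \sum_(1 <= k < M.+1) (binw n k * (k%:R * pairsum F k)
    - n%:R * (binw n k * F k)) = - (binw n M * (n%:R - M%:R) * psum F M).
  elim: M => [|M IHM]; first by rewrite big_geq// psum0 mulr0 oppr0.
  rewrite big_nat_recr//= IHM -binwS /pairsum !psumS/=; ring.
apply/eqP; rewrite -subr_eq0 {2}/wsum mulr_sumr -sumrB H.
by rewrite subrr mulr0 mul0r oppr0.
Qed.

Lemma eq_pairsum F G : (forall k, (0 < k)%N -> F k = G k) ->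
  pairsum F =1 pairsum G.
Proof. by move=> FG n; rewrite /pairsum !(eq_psum FG). Qed.

(** With signs inserted, pairsum becomes a telescoping summand: the partial
sums of (-1) ^ k * pairsum F k are (-1) ^ l * psum F l. *)
Lemma pairsum_sign F n : (0 < n)%N ->
  pairsum (fun k => (-1) ^+ k * pairsum F k) n = (-1) ^+ n * F n.
Proof.
have H l : psum (fun k => (-1) ^+ k * pairsum F k) l = (-1) ^+ l * psum F l.
  elim: l => [|l IHl]; first by rewrite !psum0 mulr0.
  rewrite psumS IHl /pairsum/= exprS; ring.
case: n => // n _; rewrite /pairsum !H/= psumS exprS; ring.
Qed.

Lemma pairsum_alt n : (0 < n)%N -> pairsum (fun k => - 2 * (-1) ^+ k) n = 2.
Proof.
have H l : psum (fun k => - 2 * (-1) ^+ k) l = 1 - (-1) ^+ l :> K.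
  elim: l => [|l IHl]; first by rewrite psum0 expr0 subrr.
  by rewrite psumS IHl exprS; ring.
by case: n => // n _; rewrite /pairsum !H exprS/=; ring.
Qed.

(** The alternating sum of row 2n of Pascal's triangle vanishes, and is
symmetric around its middle term. In the normalized form, the sum telescopes
because 2 * n * binw n k = (n + k) * binw n k + (n + k + 1) * binw n k.+1. *)
Lemma wsum_alt n : (0 < n)%N -> wsum (fun k => - 2 * (-1) ^+ k) n = 1.
Proof.
move=> n0; have nn0 : n%:R != 0 :> K by rewrite pnatr_eq0 -lt0n.
have H M : n%:R * \sum_(1 <= k < M.+1) binw n k * (- 2 * (-1) ^+ k)
    = n%:R - (-1) ^+ M * (binw n M * (n%:R - M%:R)).
  elim: M => [|M IHM]; first by rewrite big_geq// /binw big_geq//; ring.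
  rewrite big_nat_recr//= mulrDr IHM -binwS exprS; ring.
apply: (mulfI nn0); rewrite /wsum H subrr mulr0 mulr0; ring.
Qed.

(** The base F is a parameter, so that concatenation of words becomes
composition of operators. *)
Definition starsum (s : seq nat) F : nat -> K :=
  foldr (fun a f => psum (fun k => f k / k%:R ^+ a)) F s.

Lemma starsum_cat s1 s2 F : starsum (s1 ++ s2) F = starsum s1 (starsum s2 F).
Proof. exact: foldr_cat. Qed.

Lemma eq_starsum s F G : (forall k, (0 < k)%N -> F k = G k) ->
  forall k, (0 < k)%N -> starsum s F k = starsum s G k.
Proof.
move=> FG; elim: s => [|a s IHs] k k0 //=; first exact: FG.
by apply: eq_psum => l l0; rewrite IHs.
Qed.

Lemma starsum_twos m F n :
  starsum (nseq m 2) (wsum F) n = wsum (fun k => F k / k%:R ^+ (2 * m)) n.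
Proof.
elim: m n => [|m IHm] n /=.
  by apply: eq_wsum => k _; rewrite muln0 expr0 divr1.
under eq_psum do rewrite IHm.
rewrite psum_wsum.
by apply: eq_wsum => k k0; rewrite -mulrA -invfM -exprD addnC -mulnS.
Qed.

Definition signed_div m F k : K := (-1) ^+ k * F k / k%:R ^+ (2 * m).

(** The three words evaluated at the end are this one, and this one followed
either by {2}^m or by itself. *)
Definition block m : seq nat := nseq m.-1 2 ++ 3 :: nseq m.-1 2 ++ [:: 1].

(** For the entry 1, division by n is division by n ^ 2 after multiplication by
n, so it acts as F |-> pairsum F k / k. For the entry 3, the function produced
so far is k * pairsum G k for a suitable G by [pairsum_sign], so its transform
is n * wsum G n and the factor n lowers the exponent 3 to 2. *)
Lemma starsum_block m F n : (0 < m)%N -> (0 < n)%N ->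
  starsum (block m) (wsum F) n =
  wsum (signed_div m (pairsum (signed_div m (pairsum F)))) n.
Proof.
case: m => // m _ n0; rewrite /block /= -cat1s !starsum_cat.
have nat0 k : (0 < k)%N -> k%:R != 0 :> K by move=> k0; rewrite pnatr_eq0 -lt0n.
pose Q := pairsum F.
have step1 k : (0 < k)%N ->
    starsum [:: 1] (wsum F) k = wsum (fun l => Q l / l%:R) k.
  move=> _ /=; rewrite -[LHS](@eq_psum (fun l => wsum (fun i => i%:R * Q i) l / l%:R ^+ 2)).
    by rewrite psum_wsum; apply: eq_wsum => l /nat0 l0; field.
  by move=> l /nat0 l0; rewrite wsum_pairsum; field.
pose G k := (-1) ^+ k * pairsum (signed_div m.+1 Q) k.
have step2 k : (0 < k)%N ->
    starsum (nseq m 2) (starsum [:: 1] (wsum F)) k =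
    k%:R * wsum G k.
  move=> k0; rewrite (eq_starsum _ step1)// starsum_twos -wsum_pairsum.
  apply: eq_wsum => l l0; rewrite /G pairsum_sign// /signed_div mulnS exprD.
  have := nat0 _ l0; rewrite -signr_odd.
  by case: odd => l0'; field; rewrite expf_neq0.
have step3 k : (0 < k)%N ->
    starsum [:: 3] (starsum (nseq m 2) (starsum [:: 1] (wsum F))) k =
    wsum (fun l => G l / l%:R ^+ 2) k.
  move=> _; rewrite -psum_wsum /=; apply: eq_psum => l l0; rewrite step2//.
  by have := nat0 _ l0 => l0'; field.
rewrite (eq_starsum _ step3)// starsum_twos; apply: eq_wsum => k k0.
have := nat0 _ k0 => k0'.
by rewrite -mulrA -invfM -exprD -mulnS.
Qed.

(** The part of the degree d + 1 coefficient of
\prod_k (1 + x k * t) / (1 - x k * t) in which k is the largest index used. *)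
Fixpoint qterm (x : nat -> K) d k : K :=
  if d is d'.+1 then x k * pairsum (qterm x d') k else 2 * x k.

(** Comparing the coefficients of t ^ (d+2) in
(1 - x n.+1 * t) * Q_(n+1) = (1 + x n.+1 * t) * Q_n, where Q_n is the partial
product up to n. *)
Lemma psum_qtermS x d n : psum (qterm x d.+1) n.+1 =
  psum (qterm x d.+1) n
    + x n.+1 * (psum (qterm x d) n.+1 + psum (qterm x d) n).
Proof. by rewrite psumS. Qed.

Lemma psum_qterm0 x n : psum (qterm x 0) n = 2 * psum x n.
Proof. by rewrite /psum mulr_sumr. Qed.

Lemma psum_qterm1 x n : psum (qterm x 1) n = 2 * psum x n ^+ 2.
Proof.
elim: n => [|n IHn]; first by rewrite !psum0 expr0n mulr0.
by rewrite psum_qtermS IHn !psum_qterm0 !psumS; ring.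
Qed.

Lemma psum_qterm2 x n :
  psum (qterm x 2) n = (4 * psum x n ^+ 3 + 2 * psum (fun k => x k ^+ 3) n) / 3.
Proof.
elim: n => [|n IHn]; first by rewrite !psum0; ring.
by rewrite psum_qtermS IHn !psum_qterm1 !psumS; field.
Qed.

Lemma psum_qterm3 x n : psum (qterm x 3) n =
  (2 * psum x n ^+ 4 + 4 * psum x n * psum (fun k => x k ^+ 3) n) / 3.
Proof.
elim: n => [|n IHn]; first by rewrite !psum0; ring.
by rewrite psum_qtermS IHn !psum_qterm2 !psumS; field.
Qed.

End FiniteSums.

(** * Passage to the limit in weighted sums *)

Section Tannery.
Local Open Scope classical_set_scope.
Context {R : realType}.
Implicit Types (F G : nat -> R) (n k l m : nat).

Lemma binw_ge0 n k : 0 <= binw n k :> R.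
Proof.
have [nk|kn] := ltnP n k; first by rewrite binw_gt.
rewrite /binw big_nat; apply: prodr_ge0 => i /andP[_ ik].
by rewrite divr_ge0// subr_ge0 ler_nat ltnW// (leq_trans ik).
Qed.

Lemma binw_le1 n k : binw n k <= 1 :> R.
Proof.
have [nk|kn] := ltnP n k; first by rewrite binw_gt.
rewrite /binw big_nat; apply: prodr_ile1 => i /andP[_ ik].
have nk : (i <= n)%N by rewrite ltnW// (leq_trans ik).
rewrite divr_ge0 ?subr_ge0 ?ler_nat//=.
rewrite ler_pdivrMr ?ltr0n// mul1r -natrB// ler_nat.
by rewrite ltnW// ltnS (leq_trans (leq_subr _ _))// leq_addr.
Qed.

Lemma cvg_binw k : (fun n => binw n k : R) @ \oo --> (1 : R).
Proof.
elim: k => [|k IHk].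
  under eq_cvg do rewrite /binw big_geq//.
  exact: cvg_cst.
have Hk : (fun n => (n%:R - k%:R) / (n + k).+1%:R : R) @ \oo --> (1 : R).
  have -> : (fun n => (n%:R - k%:R) / (n + k).+1%:R : R) =
      (fun n => 1 - (k + k).+1%:R * harmonic (n + k)%N).
    apply/funext => n; rewrite /harmonic/=.
    have : (n + k).+1%:R != 0 :> R by rewrite pnatr_eq0.
    by move=> h; field.
  have : (fun n => 1 - (k + k).+1%:R * harmonic (n + k)%N) @ \oo
      --> (1 - (k + k).+1%:R * 0 : R).
    apply: cvgB; first exact: cvg_cst.
    apply: cvgMr.
    have /(_ R) := @cvg_harmonic.
    by rewrite -(cvg_shiftn k).
  by rewrite mulr0 subr0.
have -> : (fun n => binw n k.+1 : R) =
    (fun n => binw n k * ((n%:R - k%:R) / (n + k).+1%:R)).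
  by apply/funext => n; rewrite /binw big_nat_recr.
by have := cvgM IHk Hk; rewrite mulr1; exact.
Qed.

Lemma cvg_psum_norm F M : (forall n, psum (fun k => `|F k|) n <= M) ->
  cvgn (psum (fun k => `|F k|)).
Proof.
move=> FM; apply: nondecreasing_is_cvgn.
  apply/nondecreasing_seqP => n; by rewrite psumS lerDl.
by exists M => _ [n _ <-]; exact: FM.
Qed.

Lemma psumB F n k : (n <= k)%N ->
  psum F k - psum F n = \sum_(n.+1 <= i < k.+1) F i.
Proof.
move=> nk; rewrite /psum (big_cat_nat (n := n.+1) (p := k.+1))//=.
by rewrite addrAC subrr add0r.
Qed.

Lemma cvg_sum_nat (a b : nat) (f : nat -> nat -> R) (g : nat -> R) :
  (forall k, (f ^~ k) @ \oo --> g k) ->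
  (fun n => \sum_(a <= k < b) f n k) @ \oo --> \sum_(a <= k < b) g k.
Proof.
by move=> fg; apply: cvg_big => //; exact: add_continuous.
Qed.

(** Tannery's theorem: the weights lie in [0, 1] and tend to 1 for each fixed k,
and F is absolutely summable, so a finite part of the sum decides. *)
Lemma wsum_cvg F M (L : R) : (forall n, psum (fun k => `|F k|) n <= M) ->
  psum F @ \oo --> L -> wsum F @ \oo --> L.
Proof.
move=> FM FL; have /cvg_ex[/= S HS] := cvg_psum_norm FM.
have leS n : psum (fun k => `|F k|) n <= S.
  have nd : {homo psum (fun k => `|F k|) : n m / (n <= m)%N >-> n <= m}.
    by apply/nondecreasing_seqP => i; rewrite psumS lerDl.
  have <- : limn (psum (fun k => `|F k|)) = S by exact: cvg_lim.
  apply: nondecreasing_cvgn_le => //.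
  by apply/cvg_ex; exists S.
suff D0 : (fun n => psum F n - wsum F n) @ \oo --> (0 : R).
  have -> : wsum F = (fun n => psum F n - (psum F n - wsum F n)).
    by apply/funext => n; rewrite subKr.
  by have := cvgB FL D0; rewrite subr0; exact.
apply/cvgrPdist_le => e e0.
have e2 : 0 < e / 2 by rewrite divr_gt0.
have [N _ SN] : \forall n \near \oo, `|S - psum (fun k => `|F k|) n| <= e / 2.
  by move/cvgrPdist_le : HS; exact.
have := SN _ (leqnn N); rewrite ger0_norm ?subr_ge0// => {}SN.
have H0 : (fun n => \sum_(1 <= k < N.+1) (1 - binw n k) * F k) @ \oo --> (0 : R).
  have := @cvg_sum_nat 1 N.+1 (fun n k => (1 - binw n k) * F k) (fun=> 0).
  rewrite big1_eq; apply => k.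
  have : (fun n => (1 - binw n k) * F k) @ \oo --> ((1 - 1) * F k : R).
    by apply: cvgMl; apply: cvgB; [exact: cvg_cst|exact: cvg_binw].
  by rewrite subrr mul0r.
move/cvgrPdist_le : H0 => /(_ _ e2) H0.
near=> n.
have Nn : (N <= n)%N by near: n; exact: nbhs_infty_ge.
have H1 : `|0 - \sum_(1 <= k < N.+1) (1 - binw n k) * F k| <= e / 2.
  by near: n; exact: H0.
have -> : psum F n - wsum F n = \sum_(1 <= k < N.+1) (1 - binw n k) * F k +
    \sum_(N.+1 <= k < n.+1) (1 - binw n k) * F k.
  rewrite -big_cat_nat//= /psum /wsum -sumrB; apply: eq_bigr => k _; ring.
rewrite opprD addrA (splitr e); apply: (le_trans (ler_normB _ _)).
apply: lerD => //; apply: (le_trans (ler_norm_sum _ _ _)).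
apply: (@le_trans _ _ (psum (fun i => `|F i|) n - psum (fun i => `|F i|) N)).
  rewrite psumB//; apply: ler_sum => k _.
  by rewrite normrM ler_piMl// ger0_norm ?subr_ge0 ?binw_le1// lerBlDr lerDl binw_ge0.
by apply: le_trans SN; rewrite lerB.
Unshelve. all: by end_near.
Qed.

End Tannery.

(** * Multiple zeta star values as limits *)

Section Esum.
Local Open Scope classical_set_scope.
Context {R : realType}.
Implicit Types (s : seq nat) (a b k : nat).

Definition starterm s (t : (size s).-tuple nat) : R :=
  \prod_(i < size s) (tnth t i)%:R ^- nth 0%N s i.

Lemma starterm_ge0 s (t : (size s).-tuple nat) : 0 <= starterm t.
Proof. by apply: prodr_ge0 => i _; rewrite invr_ge0 exprn_ge0. Qed.

Lemma starsum_ge0 s n : 0 <= starsum s (fun=> 1) n :> R.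
Proof.
elim: s n => [|a s IHs] n //=; apply: sumr_ge0 => k _.
by rewrite divr_ge0// exprn_ge0.
Qed.

Lemma esum_psum (f : nat -> R) b : (forall k, 0 <= f k) ->
  \esum_(k in [set k | (k <= b)%N && (0 < k)%N]) (f k)%:E = (psum f b)%:E.
Proof.
move=> f0; have -> : [set k | (k <= b)%N && (0 < k)%N] = [set` index_iota 1 b.+1].
  by apply/seteqP; split=> k /=; rewrite mem_index_iota ltnS andbC.
rewrite esum_fset; last by move=> k _; rewrite lee_fin.
  by rewrite -fsbig_seq ?iota_uniq// sumEFin.
exact: finite_seq.
Qed.

Definition below s b : set ((size s).-tuple nat) :=
  [set t | all (leq 1) t && path geq b t].
Arguments below : clear implicits.

(** The constant c is carried along because the inner sum acquires the factor
k ^ -a from the outer index. *)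
Lemma esum_cons (P : pred nat) a s (c : R) : 0 <= c ->
  \esum_(t in [set t : (size (a :: s)).-tuple nat |
      P (thead t) && (all (leq 1) t && sorted geq t)]) (c * starterm t)%:E
  = \esum_(k in [set k | P k && (0 < k)%N])
      \esum_(t in below s k) (c * k%:R ^- a * starterm t)%:E.
Proof.
move=> c0; rewrite esum_esum; last first.
  move=> k t _ _; rewrite lee_fin.
  by rewrite !mulr_ge0 ?starterm_ge0 ?invr_ge0 ?exprn_ge0.
rewrite (@reindex_esum _ _ _ ([set k | P k && (0 < k)%N] `*`` below s) _
   (fun u => [tuple of u.1 :: u.2])).
  apply: eq_esum => -[k t] _ /=.
  rewrite -mulrA; congr (c * _)%:E; rewrite /starterm big_ord_recl/=.
  congr *%R; apply: eq_bigr => i _; congr (_%:R ^- _).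
  by rewrite !(tnth_nth 0%N).
split.
- move=> [k t] /= [/andP[Pk k0] /andP[t0 tk]].
  by rewrite theadE Pk k0 t0.
- move=> [k t] [l u] _ _ /= /(congr1 val)/= [-> tu].
  by congr pair; exact: val_inj.
- move=> t /=; case/tupleP: t => k t; rewrite theadE/= => /and3P[Pk /andP[k0 t0] tk].
  exists (k, t) => //=; rewrite Pk k0/=; split=> //.
  by rewrite /below/= t0.
Qed.

Lemma esum_below s b (c : R) : 0 <= c ->
  \esum_(t in below s b) (c * starterm t)%:E = (c * starsum s (fun=> 1) b)%:E.
Proof.
elim: s b c => [|a s IHs] b c c0.
  have -> : below [::] b = [set [tuple]].
    by apply/seteqP; split=> [t _|t ->] //=; rewrite [t]tuple0.
  by rewrite esum_set1 /starterm big_ord0//= lee_fin mulr1.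
have -> : below (a :: s) b = [set t : (size (a :: s)).-tuple nat |
      (thead t <= b)%N && (all (leq 1) t && sorted geq t)].
  apply/seteqP; split=> t /=; case/tupleP: t => k t; rewrite theadE /below/=.
    by case/and3P => /andP[-> ->] -> ->.
  by case/and3P => -> /andP[-> ->] ->.
rewrite (esum_cons (fun k => (k <= b)%N))//.
under eq_esum => k /andP[_ k0].
  rewrite IHs; last by rewrite mulr_ge0// invr_ge0 exprn_ge0.
  over.
rewrite esum_psum; last first.
  by move=> k; rewrite !mulr_ge0 ?starsum_ge0// invr_ge0 exprn_ge0.
congr _%:E; rewrite /psum mulr_sumr; apply: eq_bigr => k _.
by rewrite -!mulrA [_^-1 * _]mulrC.
Qed.

(** Only the outermost index is unbounded: once it is fixed, the inner family is
finite. *)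
Lemma mzstar_lim a s (L : R) :
  starsum (a :: s) (fun=> 1) @ \oo --> L -> mzstar R (a :: s) = L%:E.
Proof.
move=> HL; rewrite /mzstar.
have -> : @star_indices (size (a :: s)) = [set t : (size (a :: s)).-tuple nat |
      predT (thead t) && (all (leq 1) t && sorted geq t)] by [].
under eq_esum do rewrite -/(starterm _) -[starterm _]mul1r.
rewrite esum_cons//.
under eq_esum => k _.
  rewrite esum_below; last by rewrite mul1r invr_ge0 exprn_ge0.
  over.
rewrite /= -nneseries_esum; last first.
  by move=> k _; rewrite lee_fin mulr_ge0 ?starsum_ge0// mul1r invr_ge0 exprn_ge0.
apply/cvg_lim => //; rewrite -cvg_shiftS.
have -> : (fun n => (\sum_(0 <= k < n.+1 | (0 < k)%N)
   (1 * k%:R ^- a * starsum s (fun=> 1) k)%:E)%E) =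
   EFin \o starsum (a :: s) (fun=> 1 : R).
  apply/funext => n; rewrite /= sumEFin big_mkcond big_ltn//= add0r; congr EFin.
  by apply: eq_big_nat => k /andP[-> _]; rewrite mul1r mulrC.
by apply: cvg_EFin => //; exact: nearW.
Qed.

End Esum.

(** * The product formula for the hyperbolic sine *)

Section Sinh.
Local Open Scope classical_set_scope.
Context {R : realType}.
Implicit Types (F G f g : R -> R) (a b x y z : R) (n k : nat).

Lemma is_derive_le F dF b : (forall x, is_derive x 1 F (dF x)) ->
  0 <= b -> (forall x, 0 <= x <= b -> 0 <= dF x) -> F 0 <= F b.
Proof.
move=> HF b0 dF0.
have [|c cb FE] := MVT_segment b0 (fun x _ => HF x).
  apply: derivable_within_continuous => x _.
  by have /@ex_derive := HF x.
rewrite -subr_ge0 FE mulr_ge0 ?subr_ge0// dF0//.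
Qed.

Lemma is_derive_add f g x df dg : is_derive x 1 f df -> is_derive x 1 g dg ->
  is_derive x 1 (fun y => f y + g y) (df + dg).
Proof. exact: is_deriveD. Qed.

Lemma is_derive_sub f g x df dg : is_derive x 1 f df -> is_derive x 1 g dg ->
  is_derive x 1 (fun y => f y - g y) (df - dg).
Proof. exact: is_deriveB. Qed.

Lemma is_derive_mul f g x df dg : is_derive x 1 f df -> is_derive x 1 g dg ->
  is_derive x 1 (fun y => f y * g y) (df * g x + f x * dg).
Proof.
move=> Hf Hg; apply: (is_derive_eq (is_deriveM Hf Hg)).
by rewrite /GRing.scale/= addrC mulrC.
Qed.

Lemma is_derive_scale f x df c : is_derive x 1 f df ->
  is_derive x 1 (fun y => c * f y) (c * df).
Proof. exact: is_deriveZ. Qed.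

Lemma is_derive_pow f x df n : is_derive x 1 f df ->
  is_derive x 1 (fun y => f y ^+ n) (n%:R * f x ^+ n.-1 * df).
Proof.
move=> /(is_deriveX n) H; rewrite (_ : (fun y => f y ^+ n) = f ^+ n)//.
by rewrite exprfctE.
Qed.

Lemma is_derive_expM c x :
  is_derive x 1 (fun y => expR (c * y)) (c * expR (c * x)).
Proof.
have Hg := is_derive_scale c (is_derive_id x (1 : R)).
by have := is_derive1_comp (is_derive_expR (c * x)) Hg; rewrite mulr1 mulrC.
Qed.

Definition coshM a x : R := (expR (a * x) + expR (- a * x)) / 2.
Definition sinhM a x : R := (expR (a * x) - expR (- a * x)) / 2.

Lemma is_derive_coshM a x : is_derive x 1 (coshM a) (a * sinhM a x).
Proof.
rewrite (_ : coshM a = fun y => 2^-1 * (expR (a * y) + expR (- a * y))); last first.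
  by apply/funext => y; rewrite mulrC.
have H := is_derive_scale 2^-1
  (is_derive_add (is_derive_expM a x) (is_derive_expM (- a) x)).
by apply: (is_derive_eq H); rewrite /sinhM; ring.
Qed.

Lemma is_derive_sinhM a x : is_derive x 1 (sinhM a) (a * coshM a x).
Proof.
rewrite (_ : sinhM a = fun y => 2^-1 * (expR (a * y) - expR (- a * y))); last first.
  by apply/funext => y; rewrite mulrC.
have H := is_derive_scale 2^-1
  (is_derive_sub (is_derive_expM a x) (is_derive_expM (- a) x)).
by apply: (is_derive_eq H); rewrite /coshM; ring.
Qed.

Lemma coshM_ge1 a x : 1 <= coshM a x.
Proof.
rewrite /coshM ler_pdivlMr// mul1r.
have := expR_ge1Dx (a * x); have := expR_ge1Dx (- a * x); lra.
Qed.

Lemma sinhM_ge0 a x : 0 <= a -> 0 <= x -> 0 <= sinhM a x.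
Proof.
move=> a0 x0; rewrite /sinhM divr_ge0// subr_ge0 ler_expR mulNr.
by have := mulr_ge0 a0 x0; lra.
Qed.

Lemma coshM0 a : coshM a 0 = 1.
Proof. by rewrite /coshM !mulr0 expR0; field. Qed.

Lemma sinhM0 a : sinhM a 0 = 0.
Proof. by rewrite /sinhM !mulr0 expR0; field. Qed.

(** The left-hand side is 1 at x = 0 and its derivative is - cos x * u x; the
function u vanishes at 0 and has a nonnegative derivative since a <= 1. *)
Lemma coshM_cos2_le1 a x : 0 <= a <= 1 -> 0 <= x <= pi / 2 ->
  coshM a x * cos x ^+ 2 <= 1.
Proof.
move=> /andP[a0 a1] /andP[x0 xpi].
have pi0 : 0 <= pi :> R := pi_ge0 R.
have cosp y : 0 <= y <= x -> 0 <= cos y.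
  by move=> /andP[y0 yx]; apply: cos_ge0_pihalf; apply/andP; split; lra.
have sinp y : 0 <= y <= x -> 0 <= sin y.
  by move=> /andP[y0 yx]; apply: sin_ge0_pi; apply/andP; split; lra.
pose u y := 2 * (coshM a y * sin y) - a * (sinhM a y * cos y).
have u0 y : 0 <= y <= x -> 0 <= u y.
  move=> /andP[y0 yx]; have -> : 0 = u 0 by rewrite /u sinhM0 sin0; ring.
  apply: (@is_derive_le u (fun y => (2 * (a * sinhM a y * sin y + coshM a y * cos y)
     - a * (a * coshM a y * cos y + sinhM a y * - sin y)))) => //.
    move=> t; apply: is_derive_sub; apply: is_derive_scale.
      exact: is_derive_mul (is_derive_coshM a t) (is_derive_sin t).
    exact: is_derive_mul (is_derive_sinhM a t) (is_derive_cos t).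
  move=> t /andP[t0 ty].
  have tx : 0 <= t <= x by rewrite t0 (le_trans ty).
  have H1 : 0 <= a * sinhM a t * sin t.
    exact: mulr_ge0 (mulr_ge0 a0 (sinhM_ge0 a0 t0)) (sinp _ tx).
  have H2 : 0 <= coshM a t * cos t.
    by rewrite mulr_ge0 ?cosp// (le_trans _ (coshM_ge1 _ _)).
  have H3 : a * a * (coshM a t * cos t) <= coshM a t * cos t.
    by rewrite ler_piMl// mulr_ile1.
  lra.
have H (t : R) : is_derive t 1 (fun y => - 1 * (coshM a y * cos y ^+ 2)) (cos t * u t).
  apply: (is_derive_eq (is_derive_scale (- 1) (is_derive_mul (is_derive_coshM a t)
    (is_derive_pow 2 (is_derive_cos t))))).
  by rewrite /u/=; ring.
have : -1 * (coshM a 0 * cos 0 ^+ 2) <= -1 * (coshM a x * cos x ^+ 2).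
  apply: (is_derive_le H x0) => t tx.
  by rewrite mulr_ge0 ?cosp ?u0.
rewrite coshM0 cos0; lra.
Qed.

(** Integration by parts, twice, for the integral of f * cos ^ (2n) over
[0, pi / 2] when f'' = a ^ 2 * f: the explicit primitive below carries out the
reduction from the exponent 2n + 2 to 2n, and its boundary terms vanish. *)
Lemma cos_pow_primitive a f f' F0 n : f' 0 = 0 -> F0 0 = 0 ->
  (forall x, is_derive x 1 f (f' x)) ->
  (forall x, is_derive x 1 f' (a ^+ 2 * f x)) ->
  (forall x, is_derive x 1 F0 (f x)) ->
  exists F, [/\ forall x, is_derive x 1 F (f x * cos x ^+ (2 * n)), F 0 = 0
    & F (pi / 2) = F0 (pi / 2) * \prod_(1 <= k < n.+1)
        (2 * k%:R * (2 * k%:R - 1) / (a ^+ 2 + 4 * k%:R ^+ 2))].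
Proof.
move=> f'0 F00 Hf Hf' HF0; elim: n => [|n [F [HF F0' Fpi]]].
  exists F0; split=> //; last by rewrite big_geq// mulr1.
  by move=> x; rewrite muln0 expr0 mulr1.
set N : R := n.+1%:R; pose D := a ^+ 2 + 4 * N ^+ 2.
have D0 : D != 0.
  by rewrite gt_eqF// ltr_wpDl ?sqr_ge0// mulr_gt0// exprn_gt0// ltr0Sn.
pose G x := D^-1 * (f' x * cos x ^+ (2 * n.+1)
  + 2 * N * (f x * (cos x ^+ (2 * n).+1 * sin x))
  + 2 * N * (2 * N - 1) * F x).
exists G; split.
- move=> x.
  have H1 := is_derive_mul (Hf' x) (is_derive_pow (2 * n.+1) (is_derive_cos x)).
  have H2 := is_derive_scale (2 * N) (is_derive_mul (Hf x)
     (is_derive_mul (is_derive_pow (2 * n).+1 (is_derive_cos x)) (is_derive_sin x))).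
  have H3 := is_derive_scale (2 * N * (2 * N - 1)) (HF x).
  apply: (is_derive_eq (is_derive_scale D^-1
    (is_derive_add (is_derive_add H1 H2) H3))).
  apply: (mulfI D0); rewrite mulVKf//.
  have -> : (2 * n.+1)%:R = 2 * N :> R by rewrite natrM.
  have -> : (2 * n).+1%:R = 2 * N - 1 :> R by rewrite /N -!natr1 natrM; ring.
  rewrite mulnS add2n /= !exprS.
  (* the two sides differ by a multiple of cos ^ 2 + sin ^ 2 - 1 *)
  apply/eqP; rewrite -subr_eq0; apply/eqP.
  transitivity (- (2 * N * (2 * N - 1) * f x * cos x ^+ (2 * n))
    * (cos x ^+ 2 + sin x ^+ 2 - 1)); first by rewrite /D; ring.
  by rewrite cos2Dsin2 subrr mulr0.
- by rewrite /G f'0 F0' sin0; ring.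
- rewrite /G cos_pihalf !expr0n/= Fpi [in RHS]big_nat_recr//= -/N -/D.
  by field.
Qed.


(** This is sinh (pi z) / (pi z); the numerator is written at pi / 2 because it
arises from an integral over [0, pi / 2]. *)
Definition sinhc z : R := sinhM (2 * z) (pi / 2) / (pi * z).

Definition sinhprod z n : R := \prod_(1 <= k < n.+1) (1 + z ^+ 2 / k%:R ^+ 2).

(** Let I_n(z) be the integral of cosh (2zx) * cos x ^ (2n) over [0, pi / 2].
By [cos_pow_primitive], I_n(z) / I_n(0) = sinhc z / sinhprod z n. The bounds are
I_n(0) <= I_n(z), from cosh >= 1, and I_(n+1)(z) <= I_n(0), from
[coshM_cos2_le1], where I_(n+1)(0) = I_n(0) * (1 - 1 / (2n + 2)). *)
Lemma sinhprod_bounds z n : 0 < z <= 2^-1 ->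
  sinhprod z n <= sinhc z /\
  sinhc z * (1 - (2 * n.+1%:R)^-1) <= sinhprod z n.+1.
Proof.
move=> /andP[z0 z1]; have zn0 : z != 0 by rewrite gt_eqF.
have pi0 : 0 < pi :> R := pi_gt0 R.
have pihalf0 : 0 <= pi / 2 :> R by lra.
pose V m : R := \prod_(1 <= k < m.+1)
  (2 * k%:R * (2 * k%:R - 1) / ((2 * z) ^+ 2 + 4 * k%:R ^+ 2)).
pose W m : R := \prod_(1 <= k < m.+1)
  (2 * k%:R * (2 * k%:R - 1) / (0 ^+ 2 + 4 * k%:R ^+ 2)).
have V0 m : 0 < V m.
  rewrite /V big_nat; apply: prodr_gt0 => k /andP[k0 _].
  have k1 : 1 <= k%:R :> R by rewrite ler1n.
  apply: divr_gt0; first by apply: mulr_gt0; lra.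
  by rewrite ltr_wpDl ?sqr_ge0// mulr_gt0// exprn_gt0//; lra.
have VW m : V m * sinhprod z m = W m.
  rewrite /V /W /sinhprod -big_split/=; apply: eq_big_nat => k /andP[k0 _].
  have k1 : 1 <= k%:R :> R by rewrite ler1n.
  have kn0 : k%:R != 0 :> R by rewrite gt_eqF//; lra.
  have d0 : (2 * z) ^+ 2 + 4 * k%:R ^+ 2 != 0 :> R.
    by rewrite gt_eqF// ltr_wpDl ?sqr_ge0// mulr_gt0// exprn_gt0//; lra.
  by field; rewrite kn0 d0.
have HF m : exists F, [/\ forall x, is_derive x 1 F (coshM (2 * z) x * cos x ^+ (2 * m)),
    F 0 = 0 & F (pi / 2) = pi / 2 * (sinhc z * V m)].
  have [|||||F [HF F0 Fpi]] := @cos_pow_primitive (2 * z) (coshM (2 * z))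
      (fun x => 2 * z * sinhM (2 * z) x) (fun x => (2 * z)^-1 * sinhM (2 * z) x) m.
  - by rewrite sinhM0 mulr0.
  - by rewrite sinhM0 mulr0.
  - exact: is_derive_coshM.
  - move=> x; apply: (is_derive_eq (is_derive_scale (2 * z) (is_derive_sinhM (2 * z) x))).
    by rewrite mulrA.
  - move=> x; apply: (is_derive_eq (is_derive_scale (2 * z)^-1 (is_derive_sinhM (2 * z) x))).
    by rewrite mulKf// mulf_neq0.
  exists F; split=> //; rewrite Fpi -/(V m) /sinhc.
  set s := sinhM _ _; move: s; move: pi pi0 => p p0 s.
  by field; rewrite zn0 gt_eqF.
have HG m : exists G, [/\ forall x, is_derive x 1 G (cos x ^+ (2 * m)),
    G 0 = 0 & G (pi / 2) = pi / 2 * W m].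
  have G1' x : is_derive x 1 (fun=> 0 : R) (0 ^+ 2 * 1).
    by rewrite mulr1 expr0n; exact: is_derive_cst.
  have [G [HG G0 Gpi]] := @cos_pow_primitive 0 (fun=> 1) (fun=> 0) id m
    erefl erefl (fun x => is_derive_cst (1 : R) x (1 : R)) G1'
    (fun x => is_derive_id x (1 : R)).
  by exists G; split=> // x; have := HG x; rewrite mul1r.
have cosp x : 0 <= x <= pi / 2 -> 0 <= cos x.
  by move=> /andP[x0 xpi]; apply: cos_ge0_pihalf; apply/andP; split; lra.
have p2 : 0 < pi / 2 :> R by lra.
split.
- have [[F [F1 F2 F3]] [G [G1 G2 G3]]] := (HF n, HG n).
  rewrite -(ler_pM2l (V0 n)) VW [leRHS]mulrC -(ler_pM2l p2) -F3 -G3 -subr_ge0.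
  have <- : F 0 - G 0 = 0 by rewrite F2 G2 subrr.
  apply: (is_derive_le (fun x => is_derive_sub (F1 x) (G1 x))) => // x xpi.
  rewrite subr_ge0 ler_peMl ?coshM_ge1// exprn_ge0//; exact: cosp.
- have [[F [F1 F2 F3]] [G [G1 G2 G3]]] := (HF n.+1, HG n).
  have : sinhc z * V n.+1 <= W n.
    rewrite -(ler_pM2l p2) -F3 -G3 -subr_ge0.
    have <- : G 0 - F 0 = 0 by rewrite F2 G2 subrr.
    apply: (is_derive_le (fun x => is_derive_sub (G1 x) (F1 x))) => // x xpi.
    rewrite subr_ge0 mulnS exprD mulrA ler_piMl ?exprn_ge0 ?cosp//.
    by apply: coshM_cos2_le1 => //; apply/andP; split; lra.
  have n1 : 1 <= n.+1%:R :> R by rewrite ler1n.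
  have WS : W n.+1 = W n * (1 - (2 * n.+1%:R)^-1).
    rewrite /W big_nat_recr//=; congr *%R.
    by field; rewrite nat1r pnatr_eq0.
  move=> H; rewrite -(ler_pM2l (V0 n.+1)) VW WS mulrA [V _ * _]mulrC.
  apply: ler_wpM2r H; rewrite subr_ge0 invf_le1; lra.
Qed.

Lemma sinhprod_cvg z : 0 < z <= 2^-1 -> sinhprod z @ \oo --> sinhc z.
Proof.
move=> z12; rewrite -cvg_shiftS.
apply: (@squeeze_cvgr _ _ _ _ (fun n => sinhc z * (1 - (2 * n.+1%:R)^-1))
  (fun=> sinhc z)).
- apply: nearW => n; have [_ ->] := sinhprod_bounds n z12.
  by have [->] := sinhprod_bounds n.+1 z12.
- have : (fun n => sinhc z * (1 - 2^-1 * harmonic n)) @ \oo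
      --> (sinhc z * (1 - 2^-1 * 0) : R).
    apply: cvgMr; apply: cvgB; first exact: cvg_cst.
    by apply: cvgMr; exact: cvg_harmonic.
  rewrite mulr0 subr0 mulr1; under eq_fun do rewrite /harmonic/= -invfM.
  exact.
- exact: cvg_cst.
Qed.

(** Both sides satisfy u_(n+1) * (1 + z ^ 2 / (n+1) ^ 2) = u_n: for the right
one this is [wsumS_sub] with
k ^ 2 * z ^ 2 / (z ^ 2 + k ^ 2) = z ^ 2 - z ^ 4 / (z ^ 2 + k ^ 2) and
[wsum_alt]. *)
Lemma sinhprod_inv z n : (sinhprod z n)^-1 =
  1 + wsum (fun k => 2 * (-1) ^+ k * (z ^+ 2 / (z ^+ 2 + k%:R ^+ 2))) n.
Proof.
set F := fun k => _.
have nz k : (0 < k)%N -> z ^+ 2 + k%:R ^+ 2 != 0 :> R.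
  by move=> k0; rewrite gt_eqF// ltr_wpDl ?sqr_ge0// exprn_gt0// ltr0n.
elim: n => [|n IHn].
  by rewrite /sinhprod /wsum !big_geq// invr1 addr0.
have n0 : n.+1%:R != 0 :> R by rewrite pnatr_eq0.
have nzn := nz n.+1 isT.
have -> : sinhprod z n.+1 = sinhprod z n * (1 + z ^+ 2 / n.+1%:R ^+ 2).
  by rewrite /sinhprod big_nat_recr.
rewrite invfM IHn.
have := wsumS_sub F n.
have -> : wsum (fun k => k%:R ^+ 2 * F k) n.+1 =
    - z ^+ 2 * (wsum F n.+1 + 1).
  have {2}<- : wsum (fun k => - 2 * (-1) ^+ k) n.+1 = 1 :> R by exact: wsum_alt.
  rewrite /wsum -big_split mulr_sumr.
  apply: eq_big_nat => k /andP[/nz k0 _] /=; rewrite /F.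
  by field.
move=> H.
have -> : wsum F n = wsum F n.+1 + z ^+ 2 * (wsum F n.+1 + 1) / n.+1%:R ^+ 2.
  apply: (mulfI (expf_neq0 2 n0)).
  rewrite mulrDr [_ ^+ 2 * (_ / _)]mulrC mulfVK ?expf_neq0//.
  lra.
move: (n.+1%:R : R) n0 nzn => N n0; rewrite addrC => nzn.
by field; rewrite n0.
Qed.

End Sinh.

(** * Expansion of z / sinh z in alternating zeta values *)

Section Eta.
Local Open Scope classical_set_scope.
Context {R : realType}.
Implicit Types (F G : nat -> R) (z : R) (n k j J : nat).

(** Telescoping of 1 / k ^ 2 <= 1 / (k - 1) - 1 / k, from k = 2 on. *)
Lemma psum_norm_dominated F c : (forall k, (0 < k)%N -> `|F k| <= c / k%:R ^+ 2) ->
  forall n, psum (fun k => `|F k|) n <= 2 * c.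
Proof.
move=> Fc.
have c0 : 0 <= c.
  by have := Fc 1%N isT; rewrite expr1n divr1; apply: le_trans.
have H n : psum (fun k => `|F k|) n.+1 <= (2 - n.+1%:R^-1) * c.
  elim: n => [|n IHn].
    rewrite psumS psum0 add0r (le_trans (Fc 1%N isT))// expr1n invr1 mulr1; lra.
  rewrite psumS; apply: (le_trans (lerD IHn (Fc n.+2 isT))).
  rewrite [c / _]mulrC -mulrDl; apply: ler_wpM2r => //.
  have n0 : 0 <= n%:R :> R by [].
  have -> : n.+1%:R = n%:R + 1 :> R by rewrite -natr1.
  have -> : n.+2%:R = n%:R + 2 :> R by rewrite -addn2 natrD.
  move: (n%:R : R) n0 => N N0; rewrite -subr_ge0.
  have -> : 2 - (N + 2)^-1 - (2 - (N + 1)^-1 + ((N + 2) ^+ 2)^-1) =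
      ((N + 1) * (N + 2) ^+ 2)^-1 by field; rewrite !gt_eqF//; lra.
  by rewrite invr_ge0 mulr_ge0 ?exprn_ge0//; lra.
case=> [|n]; first by rewrite psum0 mulr_ge0.
apply: (le_trans (H n)); rewrite ler_wpM2r// lerBlDr lerDl invr_ge0//.
Qed.

Lemma psum_cvg F M : (forall n, psum (fun k => `|F k|) n <= M) ->
  exists2 L : R, psum F @ \oo --> L & `|L| <= M.
Proof.
move=> FM.
have E G : psum G = series (fun k => G k.+1).
  by apply/funext => n; rewrite /psum big_add1.
have : cvgn (psum F).
  rewrite E; apply: normed_cvg.
  have := cvg_psum_norm FM; rewrite E.
  exact.
move=> /cvg_ex[/= L FL]; exists L => //.
apply: (cvgr_to_le (cvg_norm FL)); apply: nearW => n.
apply: (le_trans _ (FM n)); exact: ler_norm_sum.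
Qed.

Definition altterm j k : R := (-1) ^+ k / k%:R ^+ (2 * j).

Lemma altterm_le j k : (0 < j)%N -> (0 < k)%N -> `|altterm j k| <= 1 / k%:R ^+ 2.
Proof.
case: j => // j _ k0; have k1 : 1 <= k%:R :> R by rewrite ler1n.
rewrite normrM normrX normrN1 expr1n !mul1r ger0_norm ?invr_ge0 ?exprn_ge0//.
by rewrite lef_pV2 ?posrE ?exprn_gt0 ?ltr0n// ler_weXn2l// mulnS leq_addr.
Qed.

Definition altzeta j : R := limn (psum (altterm j)).

Lemma altzeta_cvg j : (0 < j)%N -> psum (altterm j) @ \oo --> altzeta j.
Proof.
move=> j0; have [|L cL _] := @psum_cvg (altterm j) (2 * 1).
  by apply: psum_norm_dominated => k; exact: altterm_le.
by rewrite /altzeta (cvg_lim _ cL).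
Qed.

(** What is left of 2 * (-1) ^ k * z ^ 2 / (z ^ 2 + k ^ 2) after removing the
first J terms of its geometric expansion in z ^ 2 / k ^ 2. *)
Definition tail_term z J k : R := 2 * (-1) ^+ k * (-1) ^+ J *
  (z ^+ 2 / k%:R ^+ 2) ^+ J * (z ^+ 2 / (z ^+ 2 + k%:R ^+ 2)).

Lemma tail_term_le z J k : 0 < z <= 2^-1 -> (0 < k)%N ->
  `|tail_term z J k| <= 2 * z ^+ (2 * J.+1) / k%:R ^+ 2.
Proof.
move=> /andP[z0 z1] k0; have k1 : 1 <= k%:R :> R by rewrite ler1n.
have k20 : 0 < k%:R ^+ 2 :> R by rewrite exprn_gt0// ltr0n.
have z20 : 0 < z ^+ 2 by rewrite exprn_gt0.
have -> : tail_term z J k = (-1) ^+ (k + J) *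
    (2 * ((z ^+ 2 / k%:R ^+ 2) ^+ J * (z ^+ 2 / (z ^+ 2 + k%:R ^+ 2)))).
  by rewrite /tail_term exprD; ring.
have q0 : 0 <= z ^+ 2 / k%:R ^+ 2 by rewrite divr_ge0// ltW.
have d0 : 0 <= z ^+ 2 / (z ^+ 2 + k%:R ^+ 2) by rewrite divr_ge0// ltW// addr_gt0.
rewrite normrM normrX normrN1 expr1n mul1r ger0_norm; last first.
  apply: mulr_ge0 => //; apply: mulr_ge0 => //; exact: exprn_ge0.
have -> : 2 * z ^+ (2 * J.+1) / k%:R ^+ 2 =
    2 * ((z ^+ 2) ^+ J * (z ^+ 2 / k%:R ^+ 2)).
  by rewrite mulnS exprD exprM; ring.
rewrite ler_wpM2l//; apply: ler_pM.
- exact: exprn_ge0.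
- by [].
- rewrite lerXn2r ?nnegrE ?divr_ge0 ?(ltW z20) ?(ltW k20)//.
  by rewrite ler_pdivrMr// ler_peMr ?(ltW z20)// exprn_ege1.
- by rewrite ler_wpM2l ?(ltW z20)// lef_pV2 ?posrE ?addr_gt0// lerDr ltW.
Qed.

Lemma tail_term_cvg z J : 0 < z <= 2^-1 ->
  exists2 L : R, psum (tail_term z J) @ \oo --> L & `|L| <= 4 * z ^+ (2 * J.+1).
Proof.
move=> z01.
have -> : 4 * z ^+ (2 * J.+1) = 2 * (2 * z ^+ (2 * J.+1)) by ring.
by apply: psum_cvg; apply: psum_norm_dominated => k k0; exact: tail_term_le.
Qed.

Lemma psum_tail_term z J n : 0 < z -> psum (tail_term z J) n =
  2 * (-1) ^+ J * z ^+ (2 * J.+1) * psum (altterm J.+1) n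
  + psum (tail_term z J.+1) n.
Proof.
move=> z0; rewrite /psum mulr_sumr -big_split/=.
apply: eq_big_nat => k /andP[k0 _]; rewrite /tail_term /altterm !exprM.
have : k%:R ^+ 2 != 0 :> R by rewrite expf_neq0// pnatr_eq0 -lt0n.
have : z ^+ 2 + k%:R ^+ 2 != 0 :> R.
  by rewrite gt_eqF// addr_gt0// exprn_gt0// ltr0n.
move: (k%:R ^+ 2 : R) (z ^+ 2) => K Z H1 H2.
rewrite !expr_div_n !exprS; field.
by rewrite H1 H2 expf_neq0.
Qed.

(** A Taylor expansion with an explicit remainder: it avoids interchanging the
sum over k with an infinite sum over the powers of z. *)
Lemma invsinhc_expansion z J : 0 < z <= 2^-1 ->
  `|(sinhc z)^-1 - (1 + \sum_(0 <= j < J)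
     2 * (-1) ^+ j * z ^+ (2 * j.+1) * altzeta j.+1)| <= 4 * z ^+ (2 * J.+1).
Proof.
move=> z01; have /andP[z0 z1] := z01.
have s0 : 0 < sinhc z.
  have [+ _] := sinhprod_bounds 0 z01.
  rewrite /sinhprod big_geq//; exact: lt_le_trans.
have [L0 HL0 _] := tail_term_cvg 0 z01.
have -> : (sinhc z)^-1 = 1 + L0.
  have H1 : (fun n => (sinhprod z n)^-1) @ \oo --> (sinhc z)^-1.
    by apply: cvgV; [rewrite gt_eqF|exact: sinhprod_cvg].
  have H2 : (fun n => (sinhprod z n)^-1) @ \oo --> 1 + L0.
    rewrite (_ : (fun n => _) = fun n => 1 + wsum (tail_term z 0) n); last first.
      apply/funext => n; rewrite sinhprod_inv; congr (1 + _).
      by apply: eq_wsum => k k0; rewrite /tail_term !expr0 !mulr1.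
    apply: cvgD; first exact: cvg_cst.
    apply: wsum_cvg HL0; apply: psum_norm_dominated => k k0; exact: tail_term_le.
  exact: (cvg_unique _ H1 H2).
have [L HL LJ] := tail_term_cvg J z01.
suff -> : L0 = \sum_(0 <= j < J) 2 * (-1) ^+ j * z ^+ (2 * j.+1) * altzeta j.+1 + L.
  by rewrite opprD addrACA subrr add0r [_ + L]addrC addrK.
elim: J L HL {LJ} => [|J IHJ] L HL.
  by rewrite big_geq// add0r; exact: (cvg_unique _ HL0 HL).
rewrite big_nat_recr//= -addrA.
set c := 2 * _ * _; suff H : psum (tail_term z J) @ \oo --> c * altzeta J.+1 + L.
  exact: IHJ H.
rewrite (_ : psum _ = fun n => c * psum (altterm J.+1) n
  + psum (tail_term z J.+1) n); last by apply/funext => n; exact: psum_tail_term.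
by apply: cvgD => //; apply: cvgMr; exact: altzeta_cvg.
Qed.

End Eta.

(** * Alternating zeta values and Bernoulli numbers *)

Section PowerSeries.
Local Open Scope classical_set_scope.
Context {R : realType}.
Implicit Types (a b c : nat -> R) (z : R) (n k j : nat).

(** Uniqueness of Taylor coefficients: letting z tend to 0 kills the constant
coefficient, and one divides by z. *)
Lemma small_poly_eq0 c n (C d : R) : 0 < d ->
  (forall z, 0 < z <= d -> `|\sum_(0 <= s < n) c s * z ^+ s| <= C * z ^+ n) ->
  forall s, (s < n)%N -> c s = 0.
Proof.
move=> d0; elim: n c => [//|n IHn] c Hc.
have c0 : c 0%N = 0.
  apply/eqP; rewrite -normr_eq0 -[_ == 0]negbK; apply/negP => n0.
  have {}n0 : 0 < `|c 0%N| by rewrite lt_def n0 normr_ge0.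
  pose M := `|C| + \sum_(0 <= s < n) `|c s.+1|.
  have M0 : 0 <= M by rewrite addr_ge0// sumr_ge0.
  (* small enough for the constant coefficient to dominate all other terms *)
  pose e := Num.min (Num.min d 1) (`|c 0%N| / 2 / (M + 1)).
  have e0 : 0 < e by rewrite !lt_min d0 ltr01/= divr_gt0 ?divr_gt0// ltr_wpDl.
  have [ed e1 eM] : [/\ e <= d, e <= 1 & e * (M + 1) <= `|c 0%N| / 2].
    split; rewrite ?ge_min ?lexx ?orbT//.
    by rewrite -ler_pdivlMr ?ltr_wpDl// ge_min lexx orbT.
  have := Hc e; rewrite e0 ed => /(_ isT); rewrite big_nat_recl// expr0 mulr1.
  move=> H.
  have : `|c 0%N| <= e * M.
    rewrite -[c 0%N](addrK (\sum_(0 <= s < n) c s.+1 * e ^+ s.+1)).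
    apply: (le_trans (ler_normB _ _)); rewrite /M mulrDr; apply: lerD.
      apply: (le_trans H); rewrite mulrC exprS -mulrA ler_wpM2l ?(ltW e0)//.
      apply: (@le_trans _ _ (e ^+ n * `|C|)).
        by rewrite ler_wpM2l ?exprn_ge0 ?(ltW e0)// ler_norm.
      by rewrite ler_piMl// exprn_ile1// ltW.
    apply: (le_trans (ler_norm_sum _ _ _)); rewrite mulr_sumr ler_sum// => s _.
    rewrite normrM [`|e ^+ _|]ger0_norm ?exprn_ge0 ?(ltW e0)// mulrC exprS.
    rewrite -mulrA ler_wpM2l ?(ltW e0)// ler_piMl// exprn_ile1//; exact: ltW.
  have : e * M <= e * (M + 1) by rewrite ler_wpM2l ?(ltW e0)// lerDl.
  lra.
case=> [//|s] sn; apply: (IHn (c \o S)) => // z zd.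
have z0 : 0 < z by case/andP: zd.
have := Hc z zd; rewrite big_nat_recl// c0 mul0r add0r.
under eq_bigr do rewrite exprS mulrCA.
rewrite -mulr_sumr normrM gtr0_norm// exprS mulrCA ler_pM2l//.
Qed.

Lemma sum_geo_le (q : R) n N : 0 <= q <= 2^-1 -> (n <= N)%N ->
  \sum_(n <= s < N) q ^+ s <= 2 * q ^+ n.
Proof.
move=> /andP[q0 q2] nN.
suff H d : \sum_(n <= s < n + d) q ^+ s <= 2 * q ^+ n - 2 * q ^+ (n + d).
  rewrite -(subnKC nN); apply: (le_trans (H _)).
  by rewrite gerBl mulr_ge0// exprn_ge0.
elim: d => [|d IHd]; first by rewrite addn0 big_geq// subrr.
rewrite addnS big_nat_recr ?leq_addr//=.
have : q ^+ (n + d).+1 <= 2^-1 * q ^+ (n + d).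
  by rewrite exprS ler_wpM2r// exprn_ge0.
move: IHd; lra.
Qed.

(** Convergence at one point y bounds a s * y ^ s, so for z <= y / 2 the tail is
dominated by a geometric series of ratio at most 1 / 2. *)
Lemma series_trunc a (g : R -> R) (r : R) n : 0 < r ->
  (forall z, 0 < z < r -> series (fun s => a s * z ^+ s) @ \oo --> g z) ->
  exists C d : R, 0 < d /\ forall z, 0 < z <= d ->
    `|g z - \sum_(0 <= s < n) a s * z ^+ s| <= C * z ^+ n.
Proof.
move=> r0 Hg; pose y := r / 2.
have y0 : 0 < y by rewrite divr_gt0.
have [C HC] : exists C, forall s, `|a s * y ^+ s| <= C.
  have : cvgn (series (fun s => a s * y ^+ s)).
    by apply/cvg_ex; exists (g y); apply: Hg; rewrite y0/= /y; lra.
  move=> /cvg_series_bounded[M [_ HM]]; exists (M + 1) => s.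
  by apply: (HM (M + 1)) => //; rewrite ltrDl.
exists (2 * C / y ^+ n), (y / 2); split; first by rewrite divr_gt0.
move=> z /andP[z0 zy].
have Hz : series (fun s => a s * z ^+ s) @ \oo --> g z.
  by apply: Hg; rewrite z0/=; move: zy; rewrite /y; lra.
have C0 : 0 <= C by apply: le_trans (HC 0%N).
have q0 : 0 <= z / y <= 2^-1.
  by rewrite divr_ge0 ?(ltW z0) ?(ltW y0)//= ler_pdivrMr// mulrC.
set T := \sum_(0 <= s < n) _.
have H : (fun N => `|series (fun s => a s * z ^+ s) N - T|) @ \oo --> `|g z - T|.
  by apply: cvg_norm; apply: cvgB => //; exact: cvg_cst.
apply: (cvgr_to_le H); near=> N.
have nN : (n <= N)%N by near: N; exact: nbhs_infty_ge.
rewrite /series/= /T (big_cat_nat (n := n) (p := N))//= [T in T - _]addrC addrK.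
apply: (le_trans (ler_norm_sum _ _ _)).
apply: (@le_trans _ _ (\sum_(n <= s < N) C * (z / y) ^+ s)).
  apply: ler_sum => s _; rewrite expr_div_n mulrA ler_pdivlMr ?exprn_gt0//.
  rewrite normrM [`|z ^+ _|]ger0_norm ?exprn_ge0 ?(ltW z0)//.
  rewrite mulrAC ler_wpM2r ?exprn_ge0 ?(ltW z0)//.
  by have := HC s; rewrite normrM [`|y ^+ _|]ger0_norm ?exprn_ge0 ?(ltW y0).
rewrite -mulr_sumr; apply: (@le_trans _ _ (C * (2 * (z / y) ^+ n))).
  by rewrite ler_wpM2l// sum_geo_le.
by rewrite expr_div_n le_eqVlt; apply/orP; left; apply/eqP; ring.
Unshelve. all: by end_near.
Qed.

(** With t = pi z, the identity t / sinh t = 2 f(t) - f(2t) for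
f(t) = t / (e^t - 1) explains the factor 2 - 2 ^ s. *)
Lemma bernoulli_invsinhc (B : nat -> R) : bernoulli_numbers B ->
  exists2 r : R, 0 < r & forall z, 0 < z < r ->
    series (fun s => ((2 - 2 ^+ s) * B s * pi ^+ s / s`!%:R) * z ^+ s)
      @ \oo --> (sinhc z)^-1.
Proof.
move=> /nbhs_ballP[e /= e0 He].
have pi0 : 0 < pi :> R := pi_gt0 R.
exists (e / (2 * pi)); first by rewrite divr_gt0// mulr_gt0.
move=> z /andP[z0 zr]; set t := pi * z.
have t0 : 0 < t by rewrite mulr_gt0.
have te : 2 * t < e.
  by move: zr; rewrite ltr_pdivlMr ?mulr_gt0// /t => H; rewrite mulrA mulrC.
have B1 : series (fun s => B s * (t ^+ s / s`!%:R)) @ \oo --> t / (expR t - 1).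
  apply: He; last by rewrite gt_eqF.
  by rewrite /ball/= sub0r normrN gtr0_norm//; lra.
have B2 : series (fun s => B s * ((2 * t) ^+ s / s`!%:R)) @ \oo
    --> 2 * t / (expR (2 * t) - 1).
  apply: He; last by rewrite gt_eqF// mulr_gt0.
  by rewrite /ball/= sub0r normrN gtr0_norm// mulr_gt0.
have -> : (sinhc z)^-1 = 2 * (t / (expR t - 1)) - 2 * t / (expR (2 * t) - 1).
  rewrite /sinhc /sinhM.
  have -> : 2 * z * (pi / 2) = t by rewrite /t; field.
  have -> : - (2 * z) * (pi / 2) = - t by rewrite /t; field.
  rewrite -/t expRN [2 * t]mulr_natl mulr2n expRD.
  have : 1 < expR t by rewrite expR_gt1.
  move: (expR t) => u u1.
  by field; rewrite !gt_eqF//; nra.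
have E : series (fun s => (2 - 2 ^+ s) * B s * pi ^+ s / s`!%:R * z ^+ s) =
    (fun n => 2 * series (fun s => B s * (t ^+ s / s`!%:R)) n
            - series (fun s => B s * ((2 * t) ^+ s / s`!%:R)) n).
  apply/funext => n; rewrite /series/= mulr_sumr -sumrB; apply: eq_bigr => s _.
  by rewrite !exprMn; ring.
by rewrite E; apply: cvgB => //; exact: cvgMr.
Qed.

Lemma altzeta_bernoulli (B : nat -> R) j : bernoulli_numbers B -> (0 < j)%N ->
  altzeta j = (-1) ^+ (j - 1) * ((1 - 2 ^+ (2 * j - 1)) * B (2 * j)%N
    * pi ^+ (2 * j) / (2 * j)`!%:R) :> R.
Proof.
move=> /bernoulli_invsinhc[r r0 Hr]; case: j => // j _; rewrite subn1/=.
(* the coefficients at z ^ s of the two expansions of (sinhc z)^-1 *)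
pose a s := (2 - 2 ^+ s) * B s * pi ^+ s / s`!%:R.
pose b s : R := if s is s'.+1 then
  if odd s then 0 else 2 * (-1) ^+ s'./2 * altzeta s'./2.+1 else 1.
have bE J z : \sum_(0 <= s < (2 * J).+2) b s * z ^+ s =
    1 + \sum_(0 <= i < J) 2 * (-1) ^+ i * z ^+ (2 * i.+1) * altzeta i.+1.
  elim: J => [|J IHJ].
    by rewrite muln0 2?big_nat_recr//= !big_geq//=; ring.
  rewrite mulnS add2n [in LHS]big_nat_recr// [in LHS]big_nat_recr// IHJ [in RHS]big_nat_recr//=.
  rewrite mul2n odd_double/= uphalf_double -mul2n.
  by rewrite mulnS add2n !exprS; ring.
have [C [d [d0 Hd]]] := series_trunc (2 * j.+1).+2 r0 Hr.
have ab : a (2 * j.+1)%N = b (2 * j.+1)%N.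
  apply/eqP; rewrite -subr_eq0; apply/eqP.
  apply: (@small_poly_eq0 (fun s => a s - b s) (2 * j.+1).+2 (C + 4)
    (Num.min d 2^-1)); rewrite ?lt_min ?d0 ?invr_gt0 ?ltr0n// => z.
  rewrite le_min => /and3P[z0 zd z2].
  under eq_bigr do rewrite mulrBl.
  rewrite sumrB bE mulrDl.
  have := Hd z; rewrite z0 zd => /(_ isT) H1.
  have := @invsinhc_expansion _ z j.+1; rewrite z0 z2 => /(_ isT).
  rewrite (_ : (2 * j.+2)%N = (2 * j.+1).+2); last by rewrite mulnS add2n.
  move=> H2.
  move: H1 H2; rewrite !ler_distl /a => /andP[? ?] /andP[? ?].
  by apply/andP; split; lra.
move: ab; rewrite /b (_ : (2 * j.+1)%N = (2 * j).+2); last by rewrite mulnS add2n.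
rewrite /= mul2n odd_double/= uphalf_double -mul2n => ab.
have -> : altzeta j.+1 = (-1) ^+ j * (2^-1 * (2 * (-1) ^+ j * altzeta j.+1)) :> R.
  transitivity (((-1) ^+ j) ^+ 2 * altzeta j.+1 : R); last by field.
  by rewrite sqrr_sign mul1r.
rewrite -ab /a subn1/= [2 ^+ _.+2]exprS; field.
by rewrite pnatr_eq0 -lt0n fact_gt0.
Qed.

End PowerSeries.

(** * Evaluation of the words built from blocks *)

Section Blocks.
Local Open Scope classical_set_scope.
Context {R : realType}.
Implicit Types (F G : nat -> R) (m n k d : nat) (s : seq nat).

Lemma signed_divE m F k : signed_div m F k = altterm m k * F k.
Proof. by rewrite /signed_div /altterm mulrAC. Qed.

Lemma qterm_le m d : (0 < m)%N -> exists C : R, forall k, (0 < k)%N ->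
  `|qterm (altterm m) d k| <= C / k%:R ^+ 2.
Proof.
move=> m0; elim: d => [|d [C HC]].
  exists 2 => k k0 /=; rewrite normrM ger0_norm// ler_wpM2l//.
  by rewrite -[_^-1]mul1r altterm_le.
exists (2 * (2 * C)) => k k0 /=.
have H n : `|psum (qterm (altterm m) d) n| <= 2 * C.
  by apply: le_trans (psum_norm_dominated HC n); exact: ler_norm_sum.
rewrite normrM mulrC -[_ / _]mulrA -[_^-1]mul1r mulrA ler_pM ?altterm_le//.
rewrite /pairsum [X in _ <= X]mulr_natl mulr2n.
by apply: (le_trans (ler_normD _ _)); rewrite lerD.
Qed.

Lemma starsum1 s n : (0 < n)%N -> starsum s (fun=> 1) n =
  starsum s (wsum (fun k => - 2 * (-1) ^+ k)) n :> R.
Proof. by apply: eq_starsum => k k0; rewrite wsum_alt. Qed.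

Lemma starsum_twos1 m n : (0 < n)%N -> starsum (nseq m 2) (fun=> 1) n =
  wsum (fun k => - qterm (altterm m) 0 k) n :> R.
Proof.
move=> n0; rewrite starsum1// starsum_twos; apply: eq_wsum => k _ /=.
by rewrite /altterm !mulNr mulrA.
Qed.

(** Two steps of the recursion defining qterm, with a scalar that will absorb
the sign brought by {2}^m. *)
Lemma starsum_block_qterm m n (s : R) d : (0 < m)%N -> (0 < n)%N ->
  starsum (block m) (wsum (fun k => s * qterm (altterm m) d k)) n =
  wsum (fun k => s * qterm (altterm m) d.+2 k) n.
Proof.
move=> m0 n0; rewrite starsum_block//; apply: eq_wsum => k k0.
have psZ G l : pairsum (fun k => s * G k) l = s * pairsum G l.
  by rewrite /pairsum mulrDr /psum !mulr_sumr.
rewrite signed_divE /= mulrCA -psZ; congr *%R; apply: eq_pairsum => l l0.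
by rewrite signed_divE psZ mulrCA.
Qed.

Lemma starsum_block1 m n : (0 < m)%N -> (0 < n)%N ->
  starsum (block m) (fun=> 1) n = wsum (qterm (altterm m) 1) n :> R.
Proof.
move=> m0 n0; rewrite starsum1// starsum_block//; apply: eq_wsum => k k0.
rewrite signed_divE /=; congr *%R; apply: eq_pairsum => l l0.
by rewrite signed_divE pairsum_alt// mulrC.
Qed.

Lemma mzstar_wsum s F C (L : R) : s != [::] ->
  (forall n, (0 < n)%N -> starsum s (fun=> 1) n = wsum F n) ->
  (forall k, (0 < k)%N -> `|F k| <= C / k%:R ^+ 2) ->
  psum F @ \oo --> L -> mzstar R s = L%:E.
Proof.
case: s => // a s _ sF FC FL; apply: mzstar_lim.
have := wsum_cvg (psum_norm_dominated FC) FL; apply: cvg_trans.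
by apply: near_eq_cvg; near=> n; rewrite sF//; near: n; exact: nbhs_infty_gt.
Unshelve. all: by end_near.
Qed.

End Blocks.

Section Limits.
Local Open Scope classical_set_scope.
Context {R : realType} (m : nat) (m0 : (0 < m)%N).
Local Notation x := (@altterm R m).
Local Notation e1 := (@altzeta R m).
Local Notation e3 := (@altzeta R (3 * m)).

Lemma altterm_cvg : psum x @ \oo --> e1.
Proof. exact: altzeta_cvg. Qed.

(** Cubing keeps the sign (-1) ^ k, so the third power sum is again an
alternating zeta value. *)
Lemma altterm3_cvg : psum (fun k => x k ^+ 3) @ \oo --> e3.
Proof.
have -> : psum (fun k => x k ^+ 3) = psum (@altterm R (3 * m)).
  apply/funext => n; apply: eq_psum => k _; rewrite /altterm expr_div_n.
  rewrite -[(_%:R ^+ _) ^+ 3]exprM mulnAC -mulnA; congr (_ / _).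
  by rewrite -signr_odd; case: (odd k) => /=; ring.
by apply: altzeta_cvg; rewrite muln_gt0.
Qed.

Lemma qterm1_cvg : psum (qterm x 1) @ \oo --> 2 * e1 ^+ 2.
Proof.
rewrite (_ : psum _ = fun n => 2 * (psum x n * psum x n)); last first.
  by apply/funext => n; rewrite psum_qterm1.
by apply: cvgMr; apply: cvgM; exact: altterm_cvg.
Qed.

Lemma qterm2_cvg : psum (qterm x 2) @ \oo --> (4 * e1 ^+ 3 + 2 * e3) / 3.
Proof.
rewrite (_ : psum _ = fun n => (4 * (psum x n * (psum x n * psum x n))
    + 2 * psum (fun k => x k ^+ 3) n) / 3); last first.
  by apply/funext => n; rewrite psum_qterm2.
apply: cvgMl; apply: cvgD; apply: cvgMr; last exact: altterm3_cvg.
by do 2?apply: cvgM; exact: altterm_cvg.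
Qed.

Lemma qterm3_cvg : psum (qterm x 3) @ \oo --> (2 * e1 ^+ 4 + 4 * e1 * e3) / 3.
Proof.
rewrite (_ : psum _ = fun n => (2 * (psum x n * (psum x n * (psum x n * psum x n)))
    + 4 * psum x n * psum (fun k => x k ^+ 3) n) / 3); last first.
  by apply/funext => n; rewrite psum_qterm3.
apply: cvgMl; apply: cvgD.
  by apply: cvgMr; do 3?apply: cvgM; exact: altterm_cvg.
by apply: cvgM; [apply: cvgMr; exact: altterm_cvg|exact: altterm3_cvg].
Qed.

Lemma mzstar_block : mzstar R (block m) = (2 * e1 ^+ 2)%:E.
Proof.
have [C HC] := @qterm_le R m 1 m0.
apply: (mzstar_wsum _ _ HC qterm1_cvg); first by rewrite /block; case: m.-1.
by move=> n; exact: starsum_block1.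
Qed.

(** The word {2}^m alone gives - qterm 0, hence the sign. *)
Lemma mzstar_block_twos :
  mzstar R (block m ++ nseq m 2%N) = (- ((4 * e1 ^+ 3 + 2 * e3) / 3))%:E.
Proof.
have [C HC] := @qterm_le R m 2 m0.
apply: (@mzstar_wsum _ _ (fun k => - 1 * qterm x 2 k) C).
- by rewrite /block; case: m.-1.
- move=> n n0; rewrite starsum_cat -starsum_block_qterm//.
  apply: eq_starsum => // k k0; rewrite starsum_twos1//.
  by apply: eq_wsum => l _; rewrite mulN1r.
- by move=> k k0; rewrite mulN1r normrN HC.
rewrite (_ : psum _ = fun n => - psum (qterm x 2) n); last first.
  by apply/funext => n; rewrite -psumN; apply: eq_psum => k _; rewrite mulN1r.
by apply: cvgN; exact: qterm2_cvg.
Qed.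

Lemma mzstar_block_block :
  mzstar R (block m ++ block m) = ((2 * e1 ^+ 4 + 4 * e1 * e3) / 3)%:E.
Proof.
have [C HC] := @qterm_le R m 3 m0.
apply: (mzstar_wsum _ _ HC qterm3_cvg); first by rewrite /block; case: m.-1.
move=> n n0; rewrite starsum_cat.
transitivity (starsum (block m) (wsum (fun k => 1 * qterm x 1 k)) n).
  apply: eq_starsum => // k k0; rewrite starsum_block1//.
  by apply: eq_wsum => l _; rewrite mul1r.
by rewrite starsum_block_qterm//; apply: eq_wsum => l _; rewrite mul1r.
Qed.

End Limits.

Theorem corollary1p4p1 (R : realType) (B : nat -> R)
  (hB : bernoulli_numbers B) (m : nat) (hm : (0 < m)%N) :
  [/\ mzstar R (nseq m.-1 2 ++ [:: 3] ++ nseq m.-1 2 ++ [:: 1])%N =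
        (2 * pi ^+ (4 * m)
         * ((1 - 2 ^+ (2 * m - 1)) * B (2 * m)%N / ((2 * m)`!)%:R) ^+ 2)%:E,
      mzstar R (nseq m.-1 2 ++ [:: 3] ++ nseq m.-1 2 ++ [:: 1] ++ nseq m 2)%N =
        ((-1) ^+ (m - 1) * (pi ^+ (6 * m) / 3)
         * ((2 ^+ (2 * m) - 2) ^+ 3 * B (2 * m)%N ^+ 3
              / (2 * ((2 * m)`!)%:R ^+ 3)
            + (2 ^+ (6 * m) - 2) * B (6 * m)%N / ((6 * m)`!)%:R))%:E
    & mzstar R (nseq m.-1 2 ++ [:: 3] ++ nseq m.-1 2 ++ [:: 1]
                ++ nseq m.-1 2 ++ [:: 3] ++ nseq m.-1 2 ++ [:: 1])%N =
        ((2 - 2 ^+ (2 * m)) * B (2 * m)%N * pi ^+ (8 * m)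
           / (3 * ((2 * m)`!)%:R)
         * ((1 - 2 ^+ (2 * m - 1)) ^+ 3 * B (2 * m)%N ^+ 3
              / ((2 * m)`!)%:R ^+ 3
            + (2 - 2 ^+ (6 * m)) * B (6 * m)%N / ((6 * m)`!)%:R))%:E].
Proof.
have m3 : (0 < 3 * m)%N by rewrite muln_gt0.
have e1E := altzeta_bernoulli hB hm.
have e3E := altzeta_bernoulli hB m3.
have sgn3 : (-1) ^+ (3 * m - 1) = (-1) ^+ (m - 1) :> R.
  rewrite -signr_odd -[RHS]signr_odd; congr (_ ^+ _).
  by rewrite !oddB// oddM.
move: e1E e3E; rewrite sgn3 mulnA [(2 * 3)%N]/= => e1E e3E.
have pw2 : 2 ^+ (2 * m) = 2 * 2 ^+ (2 * m - 1) :> R.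
  by rewrite -exprS subn1 prednK// muln_gt0.
have pw6 : 2 ^+ (6 * m) = 2 * 2 ^+ (6 * m - 1) :> R.
  by rewrite -exprS subn1 prednK// muln_gt0.
have pi4 : pi ^+ (4 * m) = (pi ^+ (2 * m)) ^+ 2 :> R by rewrite -exprM mulnAC.
have pi6 : pi ^+ (6 * m) = (pi ^+ (2 * m)) ^+ 3 :> R by rewrite -exprM mulnAC.
have pi8 : pi ^+ (8 * m) = (pi ^+ (2 * m)) ^+ 4 :> R by rewrite -exprM mulnAC.
have f2 : (2 * m)`!%:R != 0 :> R by rewrite pnatr_eq0 -lt0n fact_gt0.
have f6 : (6 * m)`!%:R != 0 :> R by rewrite pnatr_eq0 -lt0n fact_gt0.
have sg : ((-1) ^+ (m - 1)) ^+ 2 = 1 :> R by exact: sqrr_sign.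
split.
- rewrite -[LHS]/(mzstar R (block m)) mzstar_block// e1E pi4; congr EFin.
  by rewrite exprMn sg; ring.
- rewrite [X in mzstar _ X](_ : _ = block m ++ nseq m 2%N); last first.
    by rewrite /block /= -!catA /= -!catA.
  rewrite mzstar_block_twos// e1E e3E pw2 pw6; congr EFin.
  set e := (-1) ^+ (m - 1) in sg *; set q := (X in 4 * (e * X) ^+ 3).
  set q' := (X in 2 * (e * X)).
  have -> : - ((4 * (e * q) ^+ 3 + 2 * (e * q')) / 3) =
      - e * ((4 * e ^+ 2 * q ^+ 3 + 2 * q') / 3) by ring.
  rewrite sg /q /q' pi6; move: f2 f6 (pi ^+ (2 * m)) => f2 f6 P.
  by field; rewrite f2 f6.
- rewrite [X in mzstar _ X](_ : _ = block m ++ block m); last first.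
    by rewrite /block /= -!catA /= -!catA.
  rewrite mzstar_block_block// e1E e3E pi8 pw2 pw6; congr EFin.
  set e := (-1) ^+ (m - 1) in sg *; set q := (X in 2 * (e * X) ^+ 4).
  set q' := (X in 4 * _ * (e * X)).
  have -> : (2 * (e * q) ^+ 4 + 4 * (e * q) * (e * q')) / 3 =
      (2 * (e ^+ 2) ^+ 2 * q ^+ 4 + 4 * e ^+ 2 * q * q') / 3 by ring.
  rewrite sg /q /q' pi6; move: f2 f6 (pi ^+ (2 * m)) => f2 f6 P.
  by field; rewrite f2 f6.
Qed.
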